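(* For each integer $k\geq 3$ there exists a constant $C_k>0$ such that for every positive integer $n$ there is a maximal $k$-wise intersecting family $\mathcal{F}$ of subsets of $[n]=\{1,2,\dots,n\}$ with $|\mathcal{F}|\leq C_k\cdot 2^{n/(k-1)}$.
   Context: A family $\mathcal{F}$ of subsets of $[n]$ is called $k$-wise intersecting if for all (not necessarily distinct) $X_1,\dots,X_k\in\mathcal{F}$ we have $X_1\cap\dots\cap X_k\neq\emptyset$. It is called maximal $k$-wise intersecting if it is $k$-wise intersecting and no family $\mathcal{F}'$ of subsets of $[n]$ strictly containing $\mathcal{F}$ is $k$-wise intersecting. *)

(* Defs.v *)
From mathcomp Require Import all_boot.

Set Implicit Arguments.
Unset Strict Implicit.
Unset Printing Implicit Defensive.

(* The X i need not be distinct. *)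
Definition kwise_intersecting (T : finType) (k : nat) (F : {set {set T}}) : Prop :=
  forall X : 'I_k -> {set T},
    (forall i, X i \in F) -> \bigcap_(i < k) X i != set0.

Definition maximal_kwise_intersecting (T : finType) (k : nat)
    (F : {set {set T}}) : Prop :=
  kwise_intersecting k F /\
  forall F' : {set {set T}}, F \proper F' -> ~ kwise_intersecting k F'.

(* Main.v *)
Require Import Defs.
From mathcomp Require Import all_boot all_order all_algebra.
From mathcomp Require Import boolp reals exp.

(** Pass to complements: a family of subsets of [[n]] is wanted, no [k] members
    of which cover [[n]].  Put [m = k - 1], and split [[n]] into parts
    [A_1, ..., A_m] of size at most [n / m] and a core [{s_1, ..., s_m}].  Take
    the subsets of each [A_i], together with the sets [P] plus core minus [s_i]
    for [P] a proper subset of [A_i].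

    No [m + 1] of these cover [[n]]: every part needs a set of its own, so only
    one part [A_i] receives two sets, and all sets meeting the core, being
    proper in their part, belong to that [i]; hence [s_i] is not covered.

    A set [Y] meeting two distinct parts [A_i], [A_j] completes [m] of these
    sets to a cover: in each part take [A_l \ Y], with the core minus [s_l]
    whenever [Y] meets [A_l]; the indices [i] and [j] together cover the core.
    So every maximal family above this one consists, up to complements, of
    sets meeting at most one part, and there are only [O(2 ^ (n / m))] of them. *)

Set Implicit Arguments.
Unset Strict Implicit.
Unset Printing Implicit Defensive.

Import Order.TTheory GRing.Theory Num.Theory.

Lemma maximal_kwise_intersecting_exists (T : finType) (k : nat)
    (F0 : {set {set T}}) :
  kwise_intersecting k F0 ->
  exists2 F : {set {set T}}, F0 \subset F & maximal_kwise_intersecting k F.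
Proof.
move=> F0k.
have := @maxset_exists _ (fun F : {set _} => `[< kwise_intersecting k F >]) F0.
case=> [|F /maxsetP[/asboolP Fk Fmax] F0F]; first exact/asboolP.
exists F => //; split=> // F' FF' /asboolP F'k.
have eqF := Fmax _ F'k (proper_sub FF').
by rewrite eqF properxx in FF'.
Qed.

Section Construction.

(** [c] numbers the parts outside the core [S], and the [s_i] inside it. *)
Variables (T : finType) (m : nat) (c : T -> 'I_m) (S : {set T}).

Definition part (i : 'I_m) : {set T} := [set x | (x \notin S) && (c x == i)].

(** Members are complements of the sets described above, except that the core piece may be any
    subset of the core avoiding colour [i]. *)
Definition core_family : {set {set T}} :=
  [set X | [exists i, (~: X \subset part i) ||
     (~: X \subset [set x in part i :|: S | (x \in S) ==> (c x != i)])
      && ~~ (part i \subset ~: X)]].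

Lemma core_family_kwise_intersecting :
    (forall i, exists2 x, x \in S & c x = i) ->
    (forall i, exists x, x \in part i) ->
  kwise_intersecting m.+1 core_family.
Proof.
move=> core_color part_inh X XF; apply/negP => /eqP X0.
have cover x : exists j, x \notin X j.
  apply/existsP; rewrite -negb_forall; apply/negP => /forallP xX.
  by move: (in_set0 x); rewrite -X0; move/bigcapP; apply=> j _; apply: xX.
have /choice[f fP] j : exists i, (~: X j \subset part i) ||
     (~: X j \subset [set x in part i :|: S | (x \in S) ==> (c x != i)])
      && ~~ (part i \subset ~: X j).
  by move: (XF j); rewrite inE => /existsP.
have part_idx x j : x \notin S -> x \notin X j -> f j = c x.
  move=> xS xXj; have xC : x \in ~: X j by rewrite inE.
  by case/orP: (fP j) => [/subsetP /(_ x xC)|/andP[/subsetP /(_ x xC) + _]];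
    rewrite !inE (negPf xS) ?orbF ?andbT /= => /eqP.
have f_onto i : exists j, f j = i.
  have [x] := part_inh i; rewrite inE => /andP[xS /eqP <-].
  by have [j /(part_idx _ _ xS)] := cover x; exists j.
have [j [j' [j'j fj]]] : exists j j', j' != j /\ f j' = f j.
  have /injectivePn[j [j' jj' ejj']] : ~~ injectiveb f.
    by apply/negP => /injectiveP /leq_card; rewrite !card_ord ltnn.
  by exists j, j'; rewrite eq_sym.
have [x xS cx] := core_color (f j).
have [l xXl] := cover x.
(* [~: X l] reaches the core at colour [f j], so its own colour differs and it misses a point [a] of
   its part; whatever covers [a] is a second index of that colour. *)
have [fl_neq [l' [l'l fl]]] : f l != f j /\ exists l', l' != l /\ f l' = f l.
  have xC : x \in ~: X l by rewrite inE.
  case/orP: (fP l) => [/subsetP /(_ x xC)|/andP[/subsetP /(_ x xC) xl]].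
    by rewrite inE xS.
  case/subsetPn => a; rewrite inE => /andP[aS /eqP ca] aXl.
  split; first by move: xl; rewrite !inE xS cx eq_sym.
  have [l' aXl'] := cover a; exists l'; split; last by rewrite -ca; apply: part_idx.
  by apply: contraNneq aXl => <-; rewrite inE.
(* Two colours are hit twice, so [f] stays onto after dropping [j] and [l]. *)
have onto : [set: 'I_m] \subset f @: ~: [set j; l].
  apply/subsetP => i _; have [q <-] := f_onto i.
  have [->|qj] := eqVneq q j.
    rewrite -fj; apply: imset_f; rewrite !inE negb_or j'j /=.
    by apply: contraNneq fl_neq => <-; rewrite fj.
  have [->|ql] := eqVneq q l.
    rewrite -fl; apply: imset_f; rewrite !inE negb_or l'l andbT.
    by apply: contraNneq fl_neq => <-; rewrite fl.
  by apply: imset_f; rewrite !inE negb_or qj ql.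
have := leq_trans (subset_leq_card onto) (leq_imset_card _ _).
rewrite cardsT cardsCs setCK !card_ord cards2.
have -> : j != l by apply: contraNneq fl_neq => ->.
by rewrite subSS subn1 leqNgt ltn_predL (leq_trans _ (ltn_ord (f l))).
Qed.

Lemma core_family_extension_sub (F : {set {set T}}) (Y : {set T}) :
    (0 < m)%N -> core_family \subset F -> kwise_intersecting m.+1 F ->
  Y \in F -> exists i, ~: Y \subset part i :|: S.
Proof.
move=> m_gt0 /subsetP subF Fk YF.
have [YS|/subsetPn[y]] := boolP (~: Y \subset S).
  by exists (Ordinal m_gt0); rewrite subsetU // YS orbT.
rewrite inE => yY yS; exists (c y); apply/subsetP => z; rewrite inE => zY.
apply: contraT; rewrite !inE negb_or negb_and negbK => /andP[+ zS].
rewrite (negPf zS) /= => czy.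
(* [~: Y] plays the role of the overview's [Y]. When it meets [part l], the piece [part l :&: Y] is
   proper, so core points may be added. *)
pose N l := (part l :&: Y) :|:
  (if part l \subset Y then set0 else [set x in S | c x != l]).
have NF l : ~: N l \in F.
  apply: subF; rewrite inE; apply/existsP; exists l; rewrite setCK /N.
  case: ifPn => [_|/subsetPn[x xl xY]]; first by rewrite setU0 subsetIl.
  apply/orP; right; apply/andP; split.
    apply/subsetP => x'; rewrite !inE.
    by case: (x' \in S); case: (x' \in Y); case: (c x' == l).
  apply/subsetPn; exists x => //.
  by move: xl; rewrite !inE (negPf xY) andbF /= => /andP[/negPf-> _].
pose X (o : 'I_m.+1) := if unlift ord0 o is Some l then ~: N l else Y.
have XF o : X o \in F by rewrite /X; case: unliftP => [l|] _.
have /set0Pn[x /bigcapP xX] := Fk X XF.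
have xY : x \in Y by have := xX ord0 isT; rewrite /X unlift_none.
have xN l : x \notin N l by have := xX (lift ord0 l) isT; rewrite /X liftK inE.
have xS : x \in S.
  by have := xN (c x); rewrite !inE negb_or xY eqxx !andbT negbK => /andP[].
(* A core point outside every [N l] has the colour of each part met by [~: Y]; but [y] and [z]
   differ in colour. *)
have core_idx u : u \notin Y -> u \notin S -> c x = c u.
  move=> uY uS; have := xN (c u); rewrite !inE negb_or => /andP[_].
  rewrite ifF; last by apply/negbTE/subsetPn; exists u; rewrite // inE uS /=.
  by rewrite inE xS /= negbK => /eqP.
by rewrite -(core_idx z) // -(core_idx y) // eqxx in czy.
Qed.

Lemma card_core_family_extension (a : nat) (F : {set {set T}}) :
    (0 < m)%N -> core_family \subset F -> kwise_intersecting m.+1 F ->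
    (forall i, #|part i| <= a)%N ->
  (#|F| <= m * 2 ^ (a + #|S|))%N.
Proof.
move=> m_gt0 subF Fk part_le; rewrite -(card_imset _ (@setC_inj T)).
have sub : @setC T @: F \subset \bigcup_(i < m) powerset (part i :|: S).
  apply/subsetP => _ /imsetP[Y YF ->].
  have [i Yi] := core_family_extension_sub m_gt0 subF Fk YF.
  by apply/bigcupP; exists i; rewrite // inE.
apply: leq_trans (subset_leq_card sub) _.
rewrite -[m in X in (_ <= X)%N]card_ord -sum_nat_const.
elim/big_ind2: _ => [|A p B q Ap Bq|i _]; first by rewrite cards0.
  by apply: leq_trans (leq_card_setU _ _) (leq_add _ _).
rewrite card_powerset leq_exp2l //; apply: leq_trans (leq_card_setU _ _) _.
by rewrite leq_add2r.
Qed.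

End Construction.

Lemma small_maximal_kwise_intersecting (m n : nat) : (0 < m)%N ->
  exists2 F : {set {set 'I_n}}, maximal_kwise_intersecting m.+1 F &
    (#|F| <= m * 2 ^ (n %/ m + m.*2))%N.
Proof.
(* Below [2m] points some part would be empty, but all [2 ^ n] subsets fit in the bound, so any
   maximal family will do. *)
move=> m_gt0; have [n_lt|n_ge] := ltnP n m.*2.
  have [|F _ Fmax] := @maximal_kwise_intersecting_exists 'I_n m.+1 set0.
    by move=> X /(_ ord0); rewrite inE.
  exists F => //; apply: leq_trans (max_card _) _.
  rewrite -cardsT -powersetT card_powerset cardsT card_ord.
  rewrite (leq_trans _ (leq_pmull _ _)) // leq_exp2l //.
  by rewrite (leq_trans (ltnW n_lt)) ?leq_addl.
(* Colours are residues mod [m]; the first [m] points form the core, one of each colour. *)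
pose c (x : 'I_n) : 'I_m := Ordinal (ltn_pmod x m_gt0).
pose S : {set 'I_n} := [set x : 'I_n | (x < m)%N].
have m_le : (m <= n)%N by rewrite (leq_trans _ n_ge) // -addnn leq_addl.
have [i||F subF Fmax] := maximal_kwise_intersecting_exists
    (@core_family_kwise_intersecting _ m c S _ _).
- exists (widen_ord m_le i); first by rewrite inE /=.
  by apply: val_inj; rewrite /= modn_small.
- move=> i; have im_lt : (i + m < n)%N.
    by rewrite (leq_trans _ n_ge) // -addnn ltn_add2r.
  exists (Ordinal im_lt); rewrite !inE /= -leqNgt leq_addl /=.
  by apply/eqP/val_inj; rewrite /= modnDr modn_small.
exists F => //.
have part_le i : (#|part c S i| <= n %/ m)%N.
  (* The quotient by [m] determines a point of a residue class and is nonzero off the core, which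
     leaves [n %/ m] values, not one more. *)
  have lt_div (x : 'I_n) : (x %/ m < (n %/ m).+1)%N.
    by rewrite ltnS leq_div2r // ltnW.
  pose q (x : 'I_n) : 'I_(n %/ m).+1 := Ordinal (lt_div x).
  rewrite -(@card_in_imset _ _ q); last first.
    move=> x y; rewrite !inE => /andP[_ /eqP cx] /andP[_ /eqP cy] [qxy].
    apply: val_inj; rewrite /= (divn_eq x m) (divn_eq y m) qxy.
    by have /(congr1 val) /= -> := etrans cx (esym cy).
  have card_pos : #|[set~ (ord0 : 'I_(n %/ m).+1)]| = (n %/ m)%N.
    by rewrite cardsC1 card_ord.
  rewrite -[leqRHS]card_pos; apply/subset_leq_card/subsetP => _ /imsetP[x + ->].
  by rewrite !inE -leqNgt => /andP[mx _]; rewrite -val_eqE /= -lt0n divn_gt0.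
apply: leq_trans (card_core_family_extension m_gt0 subF (proj1 Fmax) part_le) _.
rewrite leq_mul2l leq_exp2l // leq_add2l; apply/orP; right.
suff -> : #|S| = m by rewrite -addnn leq_addl.
have -> : S = widen_ord m_le @: [set: 'I_m].
  apply/setP => x; rewrite inE; apply/idP/imsetP => [xm|[i _ ->] /=] //.
  by exists (Ordinal xm); [rewrite inE | apply: val_inj].
rewrite card_imset ?cardsT ?card_ord // => i j /(congr1 val) /= ij.
exact: val_inj.
Qed.

Local Open Scope ring_scope.

Theorem theorem1 (R : realType) (k : nat) (hk : (3 <= k)%N) :
  exists C : R, 0 < C /\
    forall n : nat, (0 < n)%N ->
      exists F : {set {set 'I_n}},
        maximal_kwise_intersecting k F /\
        #|F|%:R <= C * 2 `^ (n%:R / (k%:R - 1)).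
Proof.
case: k hk => // m hm; have m_gt0 : (0 < m)%N := ltnW hm.
(* Here [m = k - 1]; the constant absorbs the number of parts and the [m.*2] in the exponent. *)
exists (m * 2 ^ m.*2)%:R; split; first by rewrite ltr0n muln_gt0 m_gt0 expn_gt0.
move=> n _; have [F Fmax Fle] := small_maximal_kwise_intersecting n m_gt0.
exists F; split => //.
have -> : m.+1%:R - 1 = m%:R :> R by rewrite -natr1 addrK.
apply: le_trans (_ : (m * 2 ^ m.*2)%:R * 2 `^ (n %/ m)%:R <= _).
  by rewrite powR_mulrn // -natrX -natrM ler_nat -mulnA -expnD addnC.
rewrite ler_wpM2l // ler_powR ?ler1n //.
by rewrite ler_pdivlMr ?ltr0n // -natrM ler_nat leq_divM.
Qed.
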